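(* Consider the velocity nonholonomic integrator (determined by the finite difference map $\rho(q_k,q_{k+1})=\left(q_k,\frac{q_{k+1}-q_k}{\epsilon}\right)$) given by the scheme $$\tilde q_{k+1}=\tilde q_k+\epsilon v_k,$$ $$v_{k+1}=v_k-\epsilon M^{-1}\nabla_qV(\tilde q_{k+1})+\epsilon(\lambda_{k+1})_\alpha M^{-1}\mu^\alpha(\tilde q_{k+1}),$$ $$\mu^\alpha(\tilde q_{k+1})\,v_{k+1}=0,$$ with initial condition satisfying $\mu^\alpha(\tilde q_k)v_k=0$, for which the multipliers are $$(\lambda_{k+1})_\alpha=-\frac1\epsilon C_{\alpha\beta}(\tilde q_{k+1})\,\mu^\beta(\tilde q_{k+1})\left(v_k-\epsilon M^{-1}\nabla_qV(\tilde q_{k+1})\right).$$ This scheme is a $(1,0)$ consistent discretization of the nonholonomic flow given by the ODE on $D=\{(q,v):\mu^\alpha(q)v=0,\ \alpha=1,\dots,m\}$ $$\dot q=v,\qquad \dot v=-M^{-1}\nabla_qV(q)+\lambda_\alpha(q,v)M^{-1}\mu^\alpha(q),$$ where $$\lambda_\alpha(q,v)=-C_{\alpha\beta}(q)\left(\frac{\partial\mu^\beta_i(q)}{\partial q^j}v^iv^j-\mu^\beta(q)M^{-1}\nabla_qV(q)\right).$$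
   Context: Repeated indices are summed. $Q=\mathbb{R}^n$; the Lagrangian is $L(q,\dot q)=\frac12\dot q^TM\dot q-V(q)$ with $M$ a constant symmetric positive definite $n\times n$ mass matrix and $V$ a smooth potential. $\mu^\alpha(q)=\mu^\alpha_i(q)dq^i$, $\alpha=1,\dots,m$, are smooth one-forms, linearly independent at each $q$; $\mu^\alpha(q)v=\mu^\alpha_i(q)v^i$, $M^{-1}\mu^\alpha$ is the vector $(M^{-1})^{ij}\mu^\alpha_j$, and $(C_{\alpha\beta}(q))$ is the inverse of the matrix $(C^{\alpha\beta}(q))=(\mu^\alpha_i(q)(M^{-1})^{ij}\mu^\beta_j(q))$. $(p,s)$ consistent discretization (order $(p,s)$ discretization of the nonholonomic problem): a sequence $\{(q_k,v_{q_k},\lambda_k)\}\subset\mathbb{R}^{2n+m}$ with $v_{q_k}\in D_{q_k}$ (i.e. $\mu^\alpha(q_k)v_{q_k}=0$) for all $k$, such that $|q(t_k+\epsilon)-q_{k+1}|=O(\epsilon^{r+1})$, $|v(t_k+\epsilon)-v_{q_{k+1}}|=O(\epsilon^{l+1})$ with $\min(r,l)=p$, and $|\lambda(t_k+\epsilon)-\lambda_{k+1}|=O(\epsilon^{s+1})$ with $s\ge0$, as $\epsilon\to0$. Here $(q(t),v(t))$ is the solution of the nonholonomic ODE with $(q(t_k),v(t_k))=(q_k,v_{q_k})$, and $\lambda(t)=\lambda(q(t),v(t))$. In the present case $q_k$ is replaced by $\tilde q_k$ and $v_{q_k}$ by $v_k$. *)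

(* Defs.v *)
From HB Require Import structures.
From mathcomp Require Export all_boot all_order all_algebra.
From mathcomp Require Export all_classical all_reals all_analysis.
Export numFieldNormedType.Exports.

Set Implicit Arguments.
Unset Strict Implicit.
Unset Printing Implicit Defensive.

Import Order.TTheory GRing.Theory Num.Theory.
Local Open Scope classical_set_scope.
Local Open Scope ring_scope.

(* Points and vectors of R^n are columns. The constraint one-forms
   mu^1, ..., mu^m are the rows of a matrix-valued map mu, so that
   mu^a(q) v is the a-th entry of mu q *m v, and sum_a l_a M^-1 mu^a(q) is
   invmx M *m (mu q)^T *m l. *)

Definition partial (R : realType) n (j : 'I_n) (f : 'cV[R]_n -> R) :
    'cV[R]_n -> R :=
  fun q => 'D_(delta_mx j 0) f q.

Fixpoint class_C (R : realType) n (k : nat) (f : 'cV[R]_n -> R) : Prop :=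
  if k is k'.+1 then
    (forall q, differentiable f q) /\
    (forall j : 'I_n, class_C k' (partial j f))
  else continuous f.

Definition smooth (R : realType) n (f : 'cV[R]_n -> R) : Prop :=
  forall k, class_C k f.

Definition grad (R : realType) n (f : 'cV[R]_n -> R) (q : 'cV[R]_n) :
    'cV[R]_n :=
  \col_j partial j f q.

Definition symmetric_posdef (R : realType) n (M : 'M[R]_n) : Prop :=
  M^T = M /\ forall x : 'cV[R]_n, x != 0 -> 0 < (x^T *m M *m x) 0 0.

Section Nonholonomic.
Variables (R : realType) (n m : nat).
Variables (M : 'M[R]_n) (V : 'cV[R]_n -> R) (mu : 'cV[R]_n -> 'M[R]_(m, n)).

Definition in_D (q v : 'cV[R]_n) : Prop := mu q *m v = 0.

(* The matrix (C_{ab}(q)), inverse of (C^{ab}(q)). *)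
Definition Cinv (q : 'cV[R]_n) : 'M[R]_m :=
  invmx (mu q *m invmx M *m (mu q)^T).

(* The vector whose b-th entry is d_j mu^b_i (q) v^i v^j. *)
Definition dmu (q v : 'cV[R]_n) : 'cV[R]_m :=
  \col_b \sum_i \sum_j partial j (fun x => mu x b i) q * v i 0 * v j 0.

Definition nh_multiplier (q v : 'cV[R]_n) : 'cV[R]_m :=
  - (Cinv q *m (dmu q v - mu q *m invmx M *m grad V q)).

(* Solutions on the compact interval [a, b], as curves in D. Derivatives are
   two-sided also at a and b: a solution with one-sided derivatives at the
   endpoints extends to such a curve. *)
Definition nh_solution (a b : R) (q v : R -> 'cV[R]_n) : Prop :=
  forall t, a <= t <= b ->
    [/\ in_D (q t) (v t),
        is_derive t 1 q (v t) &
        is_derive t 1 v (- (invmx M *m grad V (q t))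
          + invmx M *m (mu (q t))^T *m nh_multiplier (q t) (v t))].

(* A discretization is given, for each step size e > 0, by a sequence
   (q e k, v e k, lam e k), with times t_k = t0 + k e. For each k, the point
   k.+1 of the sequence is compared with (qs e, vs e), the solution through
   the point k at time t_k (which exists for small e). The norm on columns is
   the sup norm. *)
Definition consistent_discretization (p s : nat)
    (q v : R -> nat -> 'cV[R]_n) (lam : R -> nat -> 'cV[R]_m) : Prop :=
  (forall e k, 0 < e -> in_D (q e k) (v e k)) /\
  exists r l : nat, minn r l = p /\
    forall (t0 : R) (k : nat) (qs vs : R -> R -> 'cV[R]_n),
      let tk := fun e : R => t0 + e *+ k in
      (\forall e \near 0^'+,
        [/\ nh_solution (tk e) (tk e + e) (qs e) (vs e),
            qs e (tk e) = q e k & vs e (tk e) = v e k]) ->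
      [/\ (fun e => qs e (tk e + e) - q e k.+1)
            =O_ (0^'+) (fun e : R => e ^+ r.+1),
          (fun e => vs e (tk e + e) - v e k.+1)
            =O_ (0^'+) (fun e : R => e ^+ l.+1) &
          (fun e => nh_multiplier (qs e (tk e + e)) (vs e (tk e + e))
                    - lam e k.+1)
            =O_ (0^'+) (fun e : R => e ^+ s.+1)].

Definition step_update (e : R) (q v q' v' : 'cV[R]_n) (l' : 'cV[R]_m) : Prop :=
  q' = q + e *: v /\
  v' = v - e *: (invmx M *m grad V q') + e *: (invmx M *m (mu q')^T *m l').

Definition velocity_step (e : R) (q v q' v' : 'cV[R]_n) (l' : 'cV[R]_m) :
    Prop :=
  step_update e q v q' v' l' /\ in_D q' v'.

Definition step_multiplier (e : R) (v q' : 'cV[R]_n) : 'cV[R]_m :=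
  - (e^-1 *: (Cinv q' *m (mu q' *m (v - e *: (invmx M *m grad V q'))))).

End Nonholonomic.

(* Main.v *)
Require Import Defs.
From mathcomp Require Import ring lra.

(* A discrete step solves the same linear equation for the multiplier as the
   continuous problem does, with the term (d_j mu^b_i) v^i v^j replaced by the
   difference quotient (mu(q') - mu(q)) v / e; here mu(q) v = 0 is used. The
   two terms differ by O(e), and every map involved is Lipschitz on bounded
   sets, so the multipliers and the accelerations of the two problems differ by
   O(e) throughout the time step as long as the solution stays in a fixed ball.
   Real induction along the solution provides the ball, and the mean value
   inequality turns these bounds into local errors O(e^2) for q and v. For a
   fixed index k the k-th iterates are bounded uniformly in e <= 1, which makes
   the constants independent of e. *)

Set Implicit Arguments.
Unset Strict Implicit.
Unset Printing Implicit Defensive.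

Import Order.TTheory GRing.Theory Num.Theory.
Local Open Scope classical_set_scope.
Local Open Scope ring_scope.

(** * Sup norm of matrices, and boundedness of continuous functions on balls *)

Lemma mx_normP (R : realType) m n (A : 'M[R]_(m, n)) (r : R) : 0 <= r ->
  reflect (forall i j, `|A i j| <= r) (`|A| <= r).
Proof.
move=> r0; rewrite [X in X <= _]/Num.Def.normr/= mx_normrE.
apply: (iffP (bigmax_leP _ _ _ _)) => [[_ Ar] i j|Ar]; first exact: (Ar (i, j)).
by split=> // -[i j] _; exact: Ar.
Qed.

Lemma le_mx_norm (R : realType) m n (A : 'M[R]_(m, n)) i j : `|A i j| <= `|A|.
Proof. by move: i j; apply/mx_normP. Qed.

Lemma trmx_norm (R : realType) m n (A : 'M[R]_(m, n)) : `|A^T| = `|A|.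
Proof.
have le_tr k l (B : 'M[R]_(k, l)) : `|B^T| <= `|B|.
  by apply/mx_normP => // i j; rewrite mxE le_mx_norm.
by apply/le_anti; rewrite le_tr -{1}[A]trmxK le_tr.
Qed.

Lemma trmx_continuous (R : realType) m n : continuous (@trmx R m n).
Proof.
move=> A; have nA := nbhs_filter A; apply/(@cvgrPdist_lt _ _ _ _ nA) => e e0.
have /(@cvgrPdist_lt _ _ _ _ nA)/(_ _ e0) : id @ nbhs A --> A by exact: cvg_id.
by apply: filterS => B; rewrite -linearB trmx_norm.
Qed.

(** Heine-Borel for row vectors, carried over to columns by transposition, which is continuous and
    preserves the norm. *)
Lemma continuous_bounded_ball (R : realType) n (f : 'cV[R]_n -> R) (r : R) :
  continuous f -> exists B, forall x, `|x| <= r -> `|f x| <= B.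
Proof.
move=> cf; pose A : set 'rV[R]_n := [set x | `|x| <= r].
have cA : compact A.
  apply: bounded_closed_compact.
    exists r; split; first exact: num_real.
    by move=> M rM x Ax; exact: le_trans Ax (ltW rM).
  exact: (closed_comp (fun x _ => @norm_continuous _ _ x) (@closed_le _ r)).
have [B [_ /(_ (B + 1))]] : bounded_set ((f \o trmx) @` A).
  apply/compact_bounded/continuous_compact => //.
  apply: continuous_subspaceT => x; apply: continuous_comp; last exact: cf.
  exact: trmx_continuous.
rewrite ltrDl ltr01 => /(_ isT) fB; exists (B + 1) => x xr.
by apply: fB; exists x^T; rewrite /A/= ?trmx_norm ?trmxK.
Qed.

(** * Calculus of maps that are Lipschitz on every ball *)

Definition ball_lipschitz (R : realType) (X Y : normedModType R) (f : X -> Y) :=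
  forall r, exists L, forall x y, `|x| <= r -> `|y| <= r ->
    `|f x - f y| <= L * `|x - y|.

Section BallLipschitz.
Context {R : realType}.
Implicit Types X Y Z : normedModType R.

Lemma ball_lipschitz_pos X Y (f : X -> Y) : ball_lipschitz f ->
  forall r, exists2 L, 0 < L & forall x y, `|x| <= r -> `|y| <= r ->
    `|f x - f y| <= L * `|x - y|.
Proof.
move=> fL r; have [L {}fL] := fL r; exists (`|L| + 1) => [|x y xr yr].
  by rewrite ltr_wpDl.
apply: (le_trans (fL _ _ xr yr)); apply: ler_wpM2r => //.
by rewrite (le_trans (ler_norm L))// lerDl.
Qed.

Lemma ball_lipschitz_bounded X Y (f : X -> Y) : ball_lipschitz f ->
  forall r, exists2 B, 0 < B & forall x, `|x| <= r -> `|f x| <= B.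
Proof.
(* The radius [|r|] puts 0 in the ball whatever the sign of [r], so that [f x] can be compared with
   [f 0]; the summand 1 makes the bound positive. *)
move=> /ball_lipschitz_pos fL r; have [L L0 {}fL] := fL `|r|.
exists (L * `|r| + `|f 0| + 1) => [|x xr].
  by rewrite ltr_wpDl// addr_ge0// mulr_ge0// ltW.
have xr' : `|x| <= `|r| by rewrite (le_trans xr)// ler_norm.
rewrite -[f x](subrK (f 0)) (le_trans (ler_normD _ _))// -addrA lerD//.
  rewrite (le_trans (fL x 0 xr' _))// ?normr0// subr0.
  by rewrite ler_wpM2l// ltW.
by rewrite lerDl.
Qed.

Lemma ball_lipschitz_cst X Y (y : Y) : ball_lipschitz (fun _ : X => y).
Proof. by move=> r; exists 0 => *; rewrite subrr normr0 mul0r. Qed.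

Lemma ball_lipschitzD X Y (f g : X -> Y) :
  ball_lipschitz f -> ball_lipschitz g -> ball_lipschitz (fun x => f x + g x).
Proof.
move=> fL gL r; have [L {}fL] := fL r; have [L' {}gL] := gL r.
exists (L + L') => x y xr yr.
by rewrite opprD addrACA (le_trans (ler_normD _ _))// mulrDl lerD ?fL ?gL.
Qed.

Lemma ball_lipschitzN X Y (f : X -> Y) :
  ball_lipschitz f -> ball_lipschitz (fun x => - f x).
Proof.
move=> fL r; have [L {}fL] := fL r; exists L => x y xr yr.
by rewrite -opprD normrN fL.
Qed.

Lemma ball_lipschitzB X Y (f g : X -> Y) :
  ball_lipschitz f -> ball_lipschitz g -> ball_lipschitz (fun x => f x - g x).
Proof. by move=> fL gL; apply: ball_lipschitzD fL (ball_lipschitzN gL). Qed.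

Lemma ball_lipschitzM X (f g : X -> R) :
  ball_lipschitz f -> ball_lipschitz g -> ball_lipschitz (fun x => f x * g x).
Proof.
move=> fL gL r.
have [L L0 {}fL'] := ball_lipschitz_pos fL r.
have [L' L'0 {}gL'] := ball_lipschitz_pos gL r.
have [B B0 fB] := ball_lipschitz_bounded fL r.
have [B' B'0 gB] := ball_lipschitz_bounded gL r.
exists (B * L' + B' * L) => x y xr yr.
have -> : f x * g x - f y * g y = f x * (g x - g y) + g y * (f x - f y) by ring.
rewrite (le_trans (ler_normD _ _))// !normrM mulrDl -!mulrA.
by apply: lerD; apply: ler_pM => //; rewrite ?fB ?gB ?fL' ?gL'.
Qed.

Lemma ball_lipschitz_sum X Y (I : Type) (s : seq I) (f : I -> X -> Y) :
  (forall i, ball_lipschitz (f i)) -> ball_lipschitz (fun x => \sum_(i <- s) f i x).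
Proof.
move=> fL; elim: s => [|i s IH].
  by under eq_fun do rewrite big_nil; exact: ball_lipschitz_cst.
by under eq_fun do rewrite big_cons; exact: ball_lipschitzD.
Qed.

Lemma ball_lipschitz_prod X (I : Type) (s : seq I) (f : I -> X -> R) :
  (forall i, ball_lipschitz (f i)) -> ball_lipschitz (fun x => \prod_(i <- s) f i x).
Proof.
move=> fL; elim: s => [|i s IH].
  by under eq_fun do rewrite big_nil; exact: ball_lipschitz_cst.
by under eq_fun do rewrite big_cons; exact: ball_lipschitzM.
Qed.

Lemma ball_lipschitz_comp X Y Z (f : Y -> Z) (g : X -> Y) :
  ball_lipschitz f -> ball_lipschitz g -> ball_lipschitz (fun x => f (g x)).
Proof.
move=> fL gL r; have [B _ gB] := ball_lipschitz_bounded gL r.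
have [L L0 {}fL] := ball_lipschitz_pos fL B.
have [L' {}gL] := gL r.
exists (L * L') => x y xr yr.
rewrite (le_trans (fL _ _ (gB _ xr) (gB _ yr)))// -mulrA.
by rewrite ler_wpM2l ?gL// ltW.
Qed.

Lemma ball_lipschitz_fst X Y : ball_lipschitz (fun z : X * Y => z.1).
Proof.
move=> r; exists 1 => x y _ _; rewrite mul1r [leRHS]prod_normE.
by rewrite le_max lexx.
Qed.

Lemma ball_lipschitz_snd X Y : ball_lipschitz (fun z : X * Y => z.2).
Proof.
move=> r; exists 1 => x y _ _; rewrite mul1r [leRHS]prod_normE.
by rewrite le_max lexx orbT.
Qed.

Lemma ball_lipschitz_continuous X Y (f : X -> Y) :
  ball_lipschitz f -> continuous f.
Proof.
move=> fL x; have [L L0 {}fL] := ball_lipschitz_pos fL (`|x| + 1).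
apply/cvgrPdist_lt => e e0; near=> y.
have yr : `|y| <= `|x| + 1.
  rewrite -[y](subrK x) addrC (le_trans (ler_normD _ _))// lerD2l distrC.
  by near: y; apply: cvgr_dist_le.
rewrite (le_lt_trans (fL _ _ _ yr)) ?lerDl// mulrC -ltr_pdivlMr//.
by near: y; apply: cvgr_dist_lt => //; rewrite divr_gt0.
Unshelve. all: by end_near. Qed.

Lemma continuous_inv X (f : X -> R) : (forall x, f x != 0) ->
  continuous f -> continuous (fun x => (f x)^-1).
Proof. by move=> f0 cf x; apply: cvgV => //; exact: cf. Qed.

(** The domain is finite-dimensional, so the continuous function 1/f is bounded on balls by
    compactness. The difference 1/f(x) - 1/f(y) is minus the product of 1/f(x), 1/f(y) and f(x) -
    f(y). *)
Lemma ball_lipschitzV n (f : 'cV[R]_n -> R) : (forall x, f x != 0) ->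
  ball_lipschitz f -> ball_lipschitz (fun x => (f x)^-1).
Proof.
move=> f0 fL r; have [L L0 {}fL'] := ball_lipschitz_pos fL r.
have [B fB] : exists B, forall x, `|x| <= r -> `|(f x)^-1| <= B.
  apply: continuous_bounded_ball; apply: continuous_inv => //.
  exact: ball_lipschitz_continuous.
exists (B * B * L) => x y xr yr.
have -> : (f x)^-1 - (f y)^-1 = - ((f x)^-1 * (f y)^-1 * (f x - f y)).
  by field; rewrite !f0.
rewrite normrN !normrM -[B * B * L * _]mulrA; apply: ler_pM; rewrite ?mulr_ge0 ?fL' //.
by apply: ler_pM => //; exact: fB.
Qed.

Lemma ball_lipschitz_mxP X m n (f : X -> 'M[R]_(m, n)) :
  ball_lipschitz f <-> forall i j, ball_lipschitz (fun x => f x i j).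
Proof.
split=> fL => [i j r|r].
  have [L {}fL] := fL r; exists L => x y xr yr.
  by apply: le_trans (fL x y xr yr); rewrite (le_trans _ (le_mx_norm _ i j))// !mxE.
have fL' (k : 'I_m * 'I_n) : {L : R | 0 < L & forall x y, `|x| <= r -> `|y| <= r ->
    `|f x k.1 k.2 - f y k.1 k.2| <= L * `|x - y|}.
  by apply: cid2; exact: ball_lipschitz_pos.
pose L k := s2val (fL' k).
have L0 k : 0 <= L k by have := s2valP (fL' k); exact: ltW.
exists (\sum_k L k) => x y xr yr; apply/mx_normP => [|i j].
  by rewrite mulr_ge0// sumr_ge0.
rewrite !mxE (@le_trans _ _ (L (i, j) * `|x - y|))//.
  exact: (s2valP' (fL' (i, j))).
by rewrite ler_wpM2r// (bigD1 (i, j))//= lerDl sumr_ge0.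
Qed.

Lemma ball_lipschitz_mulmx X m n p (f : X -> 'M[R]_(m, n)) (g : X -> 'M[R]_(n, p)) :
  ball_lipschitz f -> ball_lipschitz g -> ball_lipschitz (fun x => f x *m g x).
Proof.
move=> /ball_lipschitz_mxP fL /ball_lipschitz_mxP gL; apply/ball_lipschitz_mxP => i j.
under eq_fun do rewrite mxE.
by apply: ball_lipschitz_sum => k; exact: ball_lipschitzM.
Qed.

Lemma ball_lipschitz_trmx X m n (f : X -> 'M[R]_(m, n)) :
  ball_lipschitz f -> ball_lipschitz (fun x => (f x)^T).
Proof.
move=> /ball_lipschitz_mxP fL; apply/ball_lipschitz_mxP => i j.
by under eq_fun do rewrite mxE; exact: fL.
Qed.

Lemma ball_lipschitz_det X n (f : X -> 'M[R]_n) :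
  ball_lipschitz f -> ball_lipschitz (fun x => \det (f x)).
Proof.
move=> /ball_lipschitz_mxP fL; apply: ball_lipschitz_sum => s.
by apply: ball_lipschitzM; [exact: ball_lipschitz_cst|exact: ball_lipschitz_prod].
Qed.

(** Cramer's rule: an entry of the inverse is a signed minor divided by the determinant, and minors
    are polynomials in the entries of [f]. *)
Lemma ball_lipschitz_invmx n m (f : 'cV[R]_n -> 'M[R]_m) :
  (forall x, f x \in unitmx) ->
  ball_lipschitz f -> ball_lipschitz (fun x => invmx (f x)).
Proof.
move=> fU fL; apply/ball_lipschitz_mxP => i j.
under eq_fun do rewrite /invmx fU !mxE.
apply: ball_lipschitzM.
  apply: ball_lipschitzV; last exact: ball_lipschitz_det.
  by move=> x; rewrite -unitfE -unitmxE.
apply: ball_lipschitzM; first exact: ball_lipschitz_cst.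
apply: ball_lipschitz_det; apply/ball_lipschitz_mxP => k l.
under eq_fun do rewrite !mxE.
by move/ball_lipschitz_mxP : fL; apply.
Qed.

End BallLipschitz.

(** * Mean value estimates along curves and lines *)

Section MeanValue.
Context {R : realType}.

Lemma is_derive_mx_entry m n (f : R -> 'M[R]_(m, n)) (t : R) df i j :
  is_derive t 1 f df -> is_derive t 1 (fun s => f s i j) (df i j).
Proof.
move=> [fd dfE]; apply: DeriveDef; first by move/derivable_mxP : fd.
by rewrite -dfE derive_mx// mxE.
Qed.

(** The scalar mean value theorem is applied to each entry of f(t) - t w; in the sup norm the
    intermediate points may differ between entries. With [w] the slope of an Euler step this bounds
    the local error, and with [w] = 0 the displacement. *)
Lemma mean_value_mx m n (f f' : R -> 'M[R]_(m, n)) (w : 'M[R]_(m, n)) (a b C : R) :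
  a <= b -> (forall t, a <= t <= b -> is_derive t 1 f (f' t)) ->
  (forall t, a < t < b -> `|f' t - w| <= C) ->
  `|f b - f a - (b - a) *: w| <= C * (b - a).
Proof.
rewrite le_eqVlt => /predU1P[<- _ _|ab df f'C].
  by rewrite !subrr scale0r subr0 normr0 mulr0.
(* The hypothesis at the midpoint forces [C] to be nonnegative. *)
have C0 : 0 <= C by apply: le_trans (f'C ((a + b) / 2) _); rewrite ?midf_lt.
apply/mx_normP => [|i j]; first by rewrite mulr_ge0// subr_ge0 ltW.
pose g : R -> R := (fun t => f t i j) - (w i j \*: id).
have dg t : a <= t <= b -> is_derive t 1 g (f' t i j - w i j *: 1).
  by move=> tab; apply: is_deriveB; apply: is_derive_mx_entry; exact: df.
have [c cab gE] : exists2 c, c \in `]a, b[%R &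
    g b - g a = (f' c i j - w i j *: 1) * (b - a).
  apply: (@MVT _ g (fun t => f' t i j - w i j *: 1)) => // [t tab|].
    by apply: dg; rewrite !ltW ?(itvP tab).
  apply: derivable_within_continuous => t tab.
  by have [] := dg t _; rewrite ?(itvP tab).
have -> : (f b - f a - (b - a) *: w) i j = g b - g a.
  by rewrite !mxE /g !fctE /=; rewrite /GRing.scale/=; ring.
have ba : 0 <= b - a by rewrite subr_ge0 ltW.
rewrite gE normrM (ger0_norm ba); apply: ler_wpM2r => //.
rewrite [w i j *: 1]mulr1.
have /f'C/mx_normP : a < c < b by rewrite !(itvP cab).
by move=> /(_ C0 i j); rewrite !mxE.
Qed.

Lemma derive_partial n (f : 'cV[R]_n -> R) x v : differentiable f x ->
  'D_v f x = \sum_j partial j f x * v j 0.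
Proof.
move=> df; rewrite deriveE// {1}[v]matrix_sum_delta linear_sum.
by apply: eq_bigr => j _; rewrite big_ord1 linearZ /= /partial deriveE// mulrC.
Qed.

Lemma is_derive_line n (f : 'cV[R]_n -> R) q v (s : R) :
  differentiable f (q + s *: v) ->
  is_derive s 1 (fun s => f (q + s *: v)) (\sum_j partial j f (q + s *: v) * v j 0).
Proof.
move=> df; rewrite -(derive_partial v df).
have E : (fun h : R => h^-1 *: (f (h *: v + (q + s *: v)) - f (q + s *: v))) =
         (fun h : R => h^-1 *: (f (q + (h *: 1 + s) *: v) - f (q + s *: v))).
  by apply/funext => h; rewrite [h *: 1]mulr1 scalerDl addrCA.
apply: DeriveDef.
  by rewrite /derivable -E; exact: diff_derivable.
by rewrite /derive -E.
Qed.

Lemma mean_value_line n (f : 'cV[R]_n -> R) q v (e : R) :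
  0 < e -> (forall x, differentiable f x) ->
  exists2 c, 0 < c < e &
    f (q + e *: v) - f q = e * \sum_j partial j f (q + c *: v) * v j 0.
Proof.
move=> e0 df.
have dg s := @is_derive_line n f q v s (df _).
have [c cab] := MVT e0 (fun s _ => dg s)
  (derivable_within_continuous (fun s _ => @ex_derive _ _ _ _ _ _ _ (dg s))).
rewrite scale0r addr0 subr0 mulrC => fE; exists c => //.
Qed.

(** Balls are convex: the segment from [y] to [x] stays in the ball, where the continuous partial
    derivatives are bounded. *)
Lemma C1_ball_lipschitz n (f : 'cV[R]_n -> R) :
  class_C 1 f -> ball_lipschitz f.
Proof.
move=> [df cf] r.
have /choice[B fB] j := continuous_bounded_ball r (cf j).
exists (\sum_j `|B j|) => x y xr yr.
have [c /andP[c0 c1]] := mean_value_line y (x - y) ltr01 df.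
rewrite scale1r subrKC mul1r => ->.
rewrite (le_trans (ler_norm_sum _ _ _))// mulr_suml ler_sum// => j _.
rewrite normrM; apply: ler_pM => //; last exact: le_mx_norm.
rewrite (le_trans _ (ler_norm _))//; apply: fB.
have -> : y + c *: (x - y) = c *: x + (1 - c) *: y.
  by rewrite scalerBr scalerBl scale1r addrCA addrC.
have c1' : 0 < 1 - c by rewrite subr_gt0.
rewrite (le_trans (ler_normD _ _))// !normrZ !gtr0_norm//.
have : c * `|x| <= c * r by rewrite ler_pM2l.
have : (1 - c) * `|y| <= (1 - c) * r by rewrite ler_pM2l.
lra.
Qed.

(** The quotient equals the directional derivative at q + c v for some 0 < c < e. This point lies in
    the ball of radius 2r as e <= 1, and the directional derivative [G] is Lipschitz there, so
    replacing q + c v by q costs at most a multiple of |c v| <= e r. *)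
Lemma difference_quotient_near n (f : 'cV[R]_n -> R) :
  (forall x, differentiable f x) -> (forall j, ball_lipschitz (partial j f)) ->
  forall r, exists2 L, 0 < L & forall e q v,
    0 < e <= 1 -> `|q| <= r -> `|v| <= r ->
    `|e^-1 * (f (q + e *: v) - f q) - \sum_j partial j f q * v j 0| <= L * e.
Proof.
move=> df pf r.
pose G (z : 'cV[R]_n * 'cV[R]_n) := \sum_j partial j f z.1 * z.2 j 0.
have GL : ball_lipschitz G.
  apply: ball_lipschitz_sum => j; apply: ball_lipschitzM.
    by apply: ball_lipschitz_comp => //; exact: ball_lipschitz_fst.
  by move/ball_lipschitz_mxP : (@ball_lipschitz_snd R 'cV[R]_n 'cV[R]_n); apply.
have [L L0 {}GL] := ball_lipschitz_pos GL (r + r).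
exists (L * (`|r| + 1)) => [|e q v /andP[e0 e1] qr vr].
  by rewrite mulr_gt0// ltr_wpDl.
have [c /andP[c0 ce] ->] := mean_value_line q v e0 df.
rewrite mulKf ?gt_eqF//.
have r0 : 0 <= r := le_trans (normr_ge0 _) qr.
have cv : `|c *: v| <= r.
  rewrite normrZ gtr0_norm// -[leRHS]mul1r; apply: ler_pM => //; first exact: ltW.
  exact/ltW/(lt_le_trans ce).
have := GL (q + c *: v, v) (q, v).
rewrite !prod_normE /= !ge_max => /(_ _ _)/le_trans; apply.
- by rewrite (le_trans (ler_normD _ _)) ?lerD// (le_trans vr)// lerDl.
- by have rr : r <= r + r; rewrite ?lerDl// (le_trans qr rr) (le_trans vr rr).
rewrite -mulrA ler_pM2l// [q + _]addrC addrK subrr normr0 ge_max.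
rewrite [_ * e]mulrC normrZ gtr0_norm// mulr_ge0 ?addr_ge0 ?(ltW e0)// andbT.
apply: ler_pM => //; [exact: ltW|exact: ltW|].
by rewrite (le_trans vr)// ger0_norm// lerDl.
Qed.

End MeanValue.

(** * Real induction on a segment, and bounds for maps of two arguments *)

Lemma segment_lt_ind (R : realType) (h : R -> R) (a b r : R) :
  (forall t, a <= t <= b -> {for t, continuous h}) ->
  (forall s, a <= s <= b -> (forall t, a <= t < s -> h t < r) -> h s < r) ->
  forall t, a <= t <= b -> h t < r.
Proof.
move=> ch step t0 t0ab; rewrite ltNge; apply/negP => ht0.
(* If the bound fails somewhere, consider the infimum of the bad times. The induction step gives the
   bound at the infimum and continuity extends it to a neighbourhood, yet bad times come arbitrarily
   close. *)
pose A : set R := [set t | a <= t <= b /\ r <= h t].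
have A0 : A t0 by [].
have lA : has_inf A by split; [exists t0|exists a => t [/andP[]]].
have sab : a <= inf A <= b.
  apply/andP; split; first by apply: lb_le_inf; [exists t0|move=> t [/andP[]]].
  by case/andP: t0ab => _; apply: le_trans; apply: (ge_inf lA.2).
have hs : h (inf A) < r.
  apply: step => // t /andP[aT ts]; rewrite ltNge; apply/negP => rt.
  have := ts; rewrite ltNge => /negP; apply; apply: (ge_inf lA.2); split => //.
  rewrite aT (le_trans (ltW ts))//; by case/andP: sab.
have /nbhs_ballP[d /= d0 hd] : \forall t \near inf A, h t < r.
  exact: (cvgr_lt _ (ch _ sab)).
have [x Ax xs] := inf_adherent d0 lA.
have sx : inf A <= x by apply: (ge_inf lA.2).
have : h x < r; last by rewrite ltNge Ax.2.
by apply: hd; rewrite /ball/= ler0_norm ?subr_le0// opprB ltrBlDl.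
Qed.

Lemma ball_lipschitz_pair (R : realType) (X Y Z : normedModType R)
    (f : X * Y -> Z) : ball_lipschitz f ->
  forall r, exists2 L, 0 < L & forall x y x' y' d,
    `|x| <= r -> `|y| <= r -> `|x'| <= r -> `|y'| <= r ->
    `|x - x'| <= d -> `|y - y'| <= d -> `|f (x, y) - f (x', y')| <= L * d.
Proof.
move=> /ball_lipschitz_pos fL r; have [L L0 {}fL] := fL r.
exists L => // x y x' y' d xr yr xr' yr' xd yd.
apply: le_trans (fL _ _ _ _) _; rewrite ?prod_normE ?ge_max ?xr ?yr ?xr' ?yr' //.
by rewrite ler_pM2l// ge_max xd.
Qed.

Lemma ball_lipschitz_pair_bounded (R : realType) (X Y Z : normedModType R)
    (f : X * Y -> Z) : ball_lipschitz f ->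
  forall r, exists2 B, 0 < B & forall x y,
    `|x| <= r -> `|y| <= r -> `|f (x, y)| <= B.
Proof.
move=> /ball_lipschitz_bounded fB r; have [B B0 {}fB] := fB r.
by exists B => // x y xr yr; apply: fB; rewrite prod_normE ge_max xr.
Qed.

(** * Invertibility of the mass matrix and of the matrix of the constraints *)

Section Posdef.
Context {R : realType} {n : nat} {M : 'M[R]_n}.
Hypothesis M_spd : symmetric_posdef M.

Lemma posdef_unit : M \in unitmx.
Proof.
rewrite -row_free_unit; apply: inj_row_free => v vM; apply/eqP/negPn/negP => v0.
have := M_spd.2 v^T; rewrite trmxK vM mul0mx mxE ltxx => H.
by have := H _; rewrite -trmx0 (inj_eq trmx_inj) => /(_ v0).
Qed.

(** If v annihilates C = A M^-1 A^T, then y = M^-1 (v A)^T satisfies y^T M y = v C v^T = 0. Hence y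
    = 0, so v A = 0, and v = 0 because the rows of [A] are independent. *)
Lemma gram_unit m (A : 'M[R]_(m, n)) : row_free A -> A *m invmx M *m A^T \in unitmx.
Proof.
move=> Afree; rewrite -row_free_unit; apply: inj_row_free => v vC.
pose y := invmx M *m (v *m A)^T.
have MtE : (invmx M)^T = invmx M by rewrite trmx_inv M_spd.1.
have : y^T *m M *m y = 0.
  rewrite /y trmx_mul trmxK MtE -!mulmxA (mulKVmx posdef_unit) trmx_mul.
  by rewrite !mulmxA -(mulmxA v) -(mulmxA v) vC mul0mx.
have [y0 _|/M_spd.2 + yE] := eqVneq y 0; last by rewrite yE mxE ltxx.
apply: (row_free_inj Afree); apply: trmx_inj.
by rewrite mul0mx trmx0 -[LHS](mulKVmx posdef_unit) -/y y0 mulmx0.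
Qed.

End Posdef.

(** * The discrete step and its multiplier *)

Section VelocityIntegrator.
Context {R : realType} {n m : nat}.
Variables (M : 'M[R]_n) (V : 'cV[R]_n -> R) (mu : 'cV[R]_n -> 'M[R]_(m, n)).
Hypothesis M_spd : symmetric_posdef M.
Hypothesis V_smooth : smooth V.
Hypothesis mu_smooth : forall a i, smooth (fun q => mu q a i).
Hypothesis mu_free : forall q, row_free (mu q).

(* Both the nonholonomic and the discrete multipliers are values of this map:
   w stands for (d_j mu^b_i) v^i v^j in the former, and for the difference
   quotient (mu(q') - mu(q)) v / e in the latter. *)
Definition multiplier_of (q : 'cV[R]_n) (w : 'cV[R]_m) : 'cV[R]_m :=
  - (Cinv M mu q *m (w - mu q *m invmx M *m grad V q)).

Definition accel (q : 'cV[R]_n) (l : 'cV[R]_m) : 'cV[R]_n :=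
  - (invmx M *m grad V q) + invmx M *m (mu q)^T *m l.

Lemma step_multiplierE e v q' : 0 < e ->
  step_multiplier M V mu e v q' = multiplier_of q' (e^-1 *: (mu q' *m v)).
Proof.
move=> e0; rewrite /step_multiplier /multiplier_of; congr (- _).
rewrite !mulmxBr scalerBr -!scalemxAr scalerA mulVf ?gt_eqF// scale1r.
by rewrite !mulmxA.
Qed.

(** Under the update equations mu(q') v' = w + e C l', so the constraint at the new point is a
    linear equation for [l'], uniquely solvable since [C] is invertible. *)
Lemma velocity_stepP e q v q' v' l' : 0 < e ->
  velocity_step M V mu e q v q' v' l' <->
  step_update M V mu e q v q' v' l' /\ l' = step_multiplier M V mu e v q'.
Proof.
move=> e0; have e_unit : e != 0 by rewrite gt_eqF.
have CU := gram_unit M_spd (mu_free q').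
set C := mu q' *m invmx M *m (mu q')^T in CU.
pose w := mu q' *m (v - e *: (invmx M *m grad V q')).
suff E : step_update M V mu e q v q' v' l' ->
    mu q' *m v' = w + e *: (C *m l').
  split=> -[st H]; split => //; move: (E st); rewrite /in_D in H *.
    rewrite H => /esym/eqP; rewrite addr_eq0 => /eqP wE.
    rewrite /step_multiplier -/w /Cinv -/C wE mulmxN scalerN opprK.
    by rewrite -scalemxAr scalerA mulVf// scale1r mulKmx.
  rewrite H => ->; rewrite /step_multiplier -/w /Cinv -/C mulmxN scalerN.
  by rewrite -scalemxAr scalerA divff// scale1r mulKVmx// subrr.
by move=> [_ ->]; rewrite mulmxDr -/w -scalemxAr !mulmxA.
Qed.

Lemma velocity_step_accel e q v q' v' l' :
  velocity_step M V mu e q v q' v' l' -> v' = v + e *: accel q' l'.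
Proof. by move=> [[_ ->] _]; rewrite /accel scalerDr scalerN addrA. Qed.

(** * Lipschitz maps of the problem and uniform bounds for one step *)

Let mu_partial_lipschitz a i j : ball_lipschitz (partial j (fun q => mu q a i)).
Proof. by apply: C1_ball_lipschitz; have [_] := mu_smooth a i 2; apply. Qed.

Lemma mu_lipschitz : ball_lipschitz mu.
Proof.
by apply/ball_lipschitz_mxP => a i; apply: C1_ball_lipschitz; exact: mu_smooth.
Qed.

Lemma grad_lipschitz : ball_lipschitz (grad V).
Proof.
apply/ball_lipschitz_mxP => j i; under eq_fun do rewrite mxE.
by apply: C1_ball_lipschitz; have [_] := V_smooth 2; apply.
Qed.

Lemma Cinv_lipschitz : ball_lipschitz (Cinv M mu).
Proof.
apply: ball_lipschitz_invmx => [q|]; first exact: gram_unit.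
apply: ball_lipschitz_mulmx; last exact/ball_lipschitz_trmx/mu_lipschitz.
by apply: ball_lipschitz_mulmx; [exact: mu_lipschitz|exact: ball_lipschitz_cst].
Qed.

Let ball_lipschitz_of_fst (X Y Z : normedModType R) (f : X -> Z) :
  ball_lipschitz f -> ball_lipschitz (fun z : X * Y => f z.1).
Proof. by move=> fL; apply: ball_lipschitz_comp => //; exact: ball_lipschitz_fst. Qed.

Lemma multiplier_of_lipschitz :
  ball_lipschitz (fun z : 'cV[R]_n * 'cV[R]_m => multiplier_of z.1 z.2).
Proof.
apply: ball_lipschitzN; apply: ball_lipschitz_mulmx.
  exact/ball_lipschitz_of_fst/Cinv_lipschitz.
apply: ball_lipschitzB; first exact: ball_lipschitz_snd.
apply: (@ball_lipschitz_of_fst _ _ _ (fun q => mu q *m invmx M *m grad V q)).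
apply: ball_lipschitz_mulmx; last exact: grad_lipschitz.
by apply: ball_lipschitz_mulmx; [exact: mu_lipschitz|exact: ball_lipschitz_cst].
Qed.

Lemma accel_lipschitz :
  ball_lipschitz (fun z : 'cV[R]_n * 'cV[R]_m => accel z.1 z.2).
Proof.
apply: ball_lipschitzD.
  apply: (@ball_lipschitz_of_fst _ _ _ (fun q => - (invmx M *m grad V q))).
  apply: ball_lipschitzN; apply: ball_lipschitz_mulmx; last exact: grad_lipschitz.
  exact: ball_lipschitz_cst.
apply: ball_lipschitz_mulmx; last exact: ball_lipschitz_snd.
apply: (@ball_lipschitz_of_fst _ _ _ (fun q => invmx M *m (mu q)^T)).
apply: ball_lipschitz_mulmx; first exact: ball_lipschitz_cst.
exact/ball_lipschitz_trmx/mu_lipschitz.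
Qed.

Lemma dmu_lipschitz :
  ball_lipschitz (fun z : 'cV[R]_n * 'cV[R]_n => dmu mu z.1 z.2).
Proof.
have snd_entry i : ball_lipschitz (fun z : 'cV[R]_n * 'cV[R]_n => z.2 i 0).
  by move/ball_lipschitz_mxP : (@ball_lipschitz_snd R 'cV[R]_n 'cV[R]_n); apply.
apply/ball_lipschitz_mxP => b k; under eq_fun do rewrite mxE.
apply: ball_lipschitz_sum => i; apply: ball_lipschitz_sum => j.
apply: ball_lipschitzM => //; apply: ball_lipschitzM => //.
exact: ball_lipschitz_of_fst.
Qed.

(** Since mu(q) v = 0, the vector mu(q + e v) v / e is the difference quotient of [mu] along [v],
    applied to [v]. Its entries are then compared with those of [dmu] by
    [difference_quotient_near]. *)
Lemma dmu_near r : exists2 L, 0 < L & forall e q v,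
  0 < e <= 1 -> `|q| <= r -> `|v| <= r -> in_D mu q v ->
  `|e^-1 *: (mu (q + e *: v) *m v) - dmu mu q v| <= L * e.
Proof.
pose fai (k : 'I_m * 'I_n) := difference_quotient_near
  (proj1 (mu_smooth k.1 k.2 1)) (mu_partial_lipschitz k.1 k.2) r.
have /choice[L LP] : forall k : 'I_m * 'I_n, exists L, 0 < L /\
    forall e q v, 0 < e <= 1 -> `|q| <= r -> `|v| <= r ->
    `|e^-1 * (mu (q + e *: v) k.1 k.2 - mu q k.1 k.2)
      - \sum_j partial j (fun q => mu q k.1 k.2) q * v j 0| <= L * e.
  by move=> k; have [L L0 LP] := fai k; exists L.
pose S := \sum_k L k.
have L0 k : 0 <= L k := ltW (LP k).1.
have S0 : 0 <= S by apply: sumr_ge0.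
exists (S * `|r| + 1) => [|e q v e01 qr vr Dqv].
  by rewrite ltr_wpDl// mulr_ge0.
have [e0 _] := andP e01.
apply/mx_normP => [|a k]; first by rewrite mulr_ge0 ?addr_ge0 ?mulr_ge0 ?(ltW e0).
have -> : e^-1 *: (mu (q + e *: v) *m v) = e^-1 *: ((mu (q + e *: v) - mu q) *m v).
  by rewrite mulmxBl Dqv subr0.
rewrite !mxE mulr_sumr -sumrB ord1.
(* Row [a] uses only the constants [L (a, i)]; their sum is at most the sum [S] over all entries. *)
rewrite (@le_trans _ _ (\sum_i L (a, i) * e * `|r|))//; last first.
  rewrite -!mulr_suml mulrDl mul1r mulrAC; apply: ler_wpDr; first exact: ltW.
  rewrite ler_wpM2r ?(ltW e0)// ler_wpM2r//.
  rewrite /S (eq_bigr (fun k => L (k.1, k.2))) => [|[]//].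
  rewrite -(pair_bigA _ (fun i j => L (i, j)))/= [leRHS](bigD1 a)//= lerDl.
  by apply: sumr_ge0 => i _; apply: sumr_ge0.
rewrite (le_trans (ler_norm_sum _ _ _))// ler_sum// => i _.
have -> : e^-1 * ((mu (q + e *: v) - mu q) a i * v i 0)
    - \sum_j partial j (fun x => mu x a i) q * v i 0 * v j 0
  = (e^-1 * (mu (q + e *: v) a i - mu q a i)
    - \sum_j partial j (fun q => mu q a i) q * v j 0) * v i 0.
  rewrite mulrBl !mxE mulrA mulr_suml; congr (_ - _).
  by apply: eq_bigr => j _; rewrite mulrAC.
rewrite normrM; apply: ler_pM => //; first exact: (LP (a, i)).2.
by rewrite (le_trans (le_mx_norm _ _ _))// (le_trans vr)// ler_norm.
Qed.

(** The factor [e^-1] in [w] does no harm, as [w] is within L e of the bounded vector [dmu mu q v].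
    Bounds for [l'], for the acceleration and for [v'] then follow in turn, uniformly in e <= 1. *)
Lemma step_bounded r : exists2 K, 0 < K & forall e q v q' v' l',
  0 < e <= 1 -> `|q| <= r -> `|v| <= r -> in_D mu q v ->
  velocity_step M V mu e q v q' v' l' ->
  let w := e^-1 *: (mu q' *m v) in
  [/\ l' = multiplier_of q' w, `|dmu mu q v - w| <= K * e,
      `|w| <= K, `|l'| <= K & (`|q'| <= K) && (`|v'| <= K)].
Proof.
have [L L0 Lw] := dmu_near r.
have [Bd Bd0 dB] := ball_lipschitz_pair_bounded dmu_lipschitz r.
pose s := Bd + L + (`|r| + `|r|).
have [Bl Bl0 lB] := ball_lipschitz_pair_bounded multiplier_of_lipschitz s.
have [Ba Ba0 aB] := ball_lipschitz_pair_bounded accel_lipschitz (s + Bl).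
have r0 := normr_ge0 r.
exists (s + Bl + Ba) => [|e q v q' v' l' e01 qr vr Dqv st w].
  by rewrite /s; lra.
have [e0 e1] := andP e01.
have rr := ler_norm r.
have q'E : q' = q + e *: v := st.1.1.
have q's : `|q'| <= `|r| + `|r|.
  rewrite q'E (le_trans (ler_normD _ _))// lerD ?(le_trans qr)//.
  by rewrite normrZ gtr0_norm// -[leRHS]mul1r ler_pM ?(ltW e0)// (le_trans vr).
have wd : `|dmu mu q v - w| <= L * e by rewrite distrC /w q'E Lw.
have Le : L * e <= L by rewrite ler_piMr// ltW.
have ws : `|w| <= Bd + L.
  rewrite -[w](subrK (dmu mu q v)) (le_trans (ler_normD _ _))// addrC lerD//.
    exact: (dB q v).
  by rewrite distrC (le_trans wd).
have lE : l' = multiplier_of q' w.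
  by rewrite -step_multiplierE//; have [/(_ st)[]] := velocity_stepP q v q' v' l' e0.
have ls : `|l'| <= Bl by rewrite lE; apply: (lB q' w); rewrite /s; lra.
split=> //; rewrite /s; try lra.
  by apply: (le_trans wd); rewrite ler_pM2r//; lra.
apply/andP; split; first lra.
have as_ : `|accel q' l'| <= Ba by apply: (aB q' l'); rewrite /s; lra.
rewrite (velocity_step_accel st) (le_trans (ler_normD _ _))//.
have : `|e *: accel q' l'| <= Ba.
  by rewrite normrZ gtr0_norm// -[leRHS]mul1r ler_pM// ltW.
lra.
Qed.

(** * A priori bounds for the exact solution, and local errors *)

Lemma nh_solution_near r : exists L e0, [/\ 0 < L, 0 < e0 &
  forall e a qs vs, 0 < e < e0 -> nh_solution M V mu a (a + e) qs vs ->
    `|qs a| <= r -> `|vs a| <= r -> forall t, a <= t <= a + e ->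
    [/\ `|qs t| <= r + 1, `|vs t| <= r + 1,
        `|qs t - qs a| <= L * e & `|vs t - vs a| <= L * e]].
Proof.
have [Bd Bd0 dB] := ball_lipschitz_pair_bounded dmu_lipschitz (r + 1).
have [Bl Bl0 lB] :=
  ball_lipschitz_pair_bounded multiplier_of_lipschitz (`|r| + 1 + Bd).
have [Ba Ba0 aB] :=
  ball_lipschitz_pair_bounded accel_lipschitz (`|r| + 1 + Bl).
have r0 := normr_ge0 r; have rr := ler_norm r.
(* [L] bounds both velocity and acceleration while the solution is in the ball of radius r + 1. For
   e < 1/L the displacement is below 1, so a solution starting within radius [r] cannot leave that
   ball. *)
pose L := `|r| + 1 + Ba.
have L0 : 0 < L by rewrite /L; lra.
exists L, L^-1; split => //; first by rewrite invr_gt0.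
move=> e a qs vs /andP[e0 eL] sol qa va.
have Le : L * e < 1 by rewrite mulrC -ltr_pdivlMr// mul1r.
pose acc t := accel (qs t) (nh_multiplier M V mu (qs t) (vs t)).
have dq t : a <= t <= a + e -> is_derive t 1 qs (vs t) by move/sol => [].
have dv t : a <= t <= a + e -> is_derive t 1 vs (acc t) by move/sol => [].
have accB t : `|qs t| <= r + 1 -> `|vs t| <= r + 1 -> `|acc t| <= L.
  move=> qt vt; have wt := dB _ _ qt vt.
  have lt : `|nh_multiplier M V mu (qs t) (vs t)| <= Bl.
    by apply: (lB (qs t) (dmu mu (qs t) (vs t))); lra.
  apply: le_trans (_ : _ <= Ba) _; last by rewrite /L; lra.
  by apply: aB; lra.
(* A bound at all times before [s] controls the displacement up to [s], because the mean value
   inequality uses derivatives at interior points only. *)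
have est s : a <= s <= a + e ->
    (forall t, a <= t < s -> `|qs t| <= r + 1 /\ `|vs t| <= r + 1) ->
    `|qs s - qs a| <= L * e /\ `|vs s - vs a| <= L * e.
  move=> /andP[as_ se] lt_s.
  have Lse : L * (s - a) <= L * e by rewrite ler_pM2l// lerBlDl.
  have sub t : a <= t <= s -> a <= t <= a + e.
    by move=> /andP[-> /le_trans]; apply.
  split; apply: le_trans Lse.
    have := @mean_value_mx _ _ _ qs vs 0 a s L as_ (fun t ts => dq t (sub t ts)).
    rewrite scaler0 subr0; apply => t /andP[at_ ts]; rewrite subr0.
    by have [|_] := lt_s t; [rewrite (ltW at_)|rewrite /L; lra].
  have := @mean_value_mx _ _ _ vs acc 0 a s L as_ (fun t ts => dv t (sub t ts)).
  rewrite scaler0 subr0; apply => t /andP[at_ ts]; rewrite subr0.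
  by have [|] := lt_s t; [rewrite (ltW at_)|exact: accB].
(* Real induction treats position and velocity together through the larger of their norms. *)
pose h := (fun t => `|qs t|) \max (fun t => `|vs t|).
have bnd : forall t, a <= t <= a + e -> h t < r + 1.
  apply: segment_lt_ind => [t tab|s sab lt_s].
    apply: continuous_max.
      apply: cvg_norm; apply/differentiable_continuous/derivable1_diffP.
      by case: (dq t tab).
    apply: cvg_norm; apply/differentiable_continuous/derivable1_diffP.
    by case: (dv t tab).
  have [|qe ve] := est s sab.
    move=> t /lt_s; rewrite gt_max => /andP[q1 v1].
    by rewrite !ltW.
  rewrite gt_max; apply/andP; split.
    rewrite -[qs s](subrK (qs a)) (le_lt_trans (ler_normD _ _))//; lra.
  rewrite -[vs s](subrK (vs a)) (le_lt_trans (ler_normD _ _))//; lra.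
have {}bnd t : a <= t <= a + e -> `|qs t| <= r + 1 /\ `|vs t| <= r + 1.
  by move/bnd; rewrite gt_max => /andP[q1 v1]; rewrite !ltW.
move=> t tab; have [qt vt] := bnd t tab.
have [|qe ve] := est t tab; last by split.
move=> u /andP[au ut]; apply: bnd; rewrite au (le_trans (ltW ut))//.
by have [] := andP tab.
Qed.

(** Throughout the step, velocity and acceleration differ by O(e) from the constant slopes v and
    [accel q' l'] of the scheme. Integration over a time e gains one power for q and v; the
    multiplier is not integrated and keeps the error O(e). *)
Lemma one_step_error r : exists C e0, [/\ 0 < C, 0 < e0 &
  forall e a q v q' v' l' qs vs, 0 < e < e0 ->
    `|q| <= r -> `|v| <= r -> in_D mu q v ->
    velocity_step M V mu e q v q' v' l' ->
    nh_solution M V mu a (a + e) qs vs -> qs a = q -> vs a = v ->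
    [/\ `|qs (a + e) - q'| <= C * e ^+ 2, `|vs (a + e) - v'| <= C * e ^+ 2 &
        `|nh_multiplier M V mu (qs (a + e)) (vs (a + e)) - l'| <= C * e]].
Proof.
have [K K0 stepK] := step_bounded r.
have [L [e1 [L0 e10 solL]]] := nh_solution_near r.
have [Ld Ld0 dL] := ball_lipschitz_pair dmu_lipschitz (r + 1).
have [Bd Bd0 dB] := ball_lipschitz_pair_bounded dmu_lipschitz (r + 1).
(* A common radius for the exact solution, the discrete step and the values of [dmu]. *)
pose s := `|r| + 1 + K + Bd.
have [Ll Ll0 lL] := ball_lipschitz_pair multiplier_of_lipschitz s.
have [Bl Bl0 lB] := ball_lipschitz_pair_bounded multiplier_of_lipschitz s.
have [La La0 aL] := ball_lipschitz_pair accel_lipschitz (s + Bl).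
have r0 := normr_ge0 r.
have [r_s K_s Bd_s] : [/\ r + 1 <= s, K <= s & Bd <= s].
  by rewrite /s; have := ler_norm r; split; lra.
have s_sl : s <= s + Bl by rewrite lerDl ltW.
have Bl_sl : Bl <= s + Bl by rewrite lerDr; lra.
(* L + |r| bounds the distance from [qs t] to q and on to q' = q + e v, per unit of e; Ld L + K does
   so from [dmu] along the solution to [dmu mu q v] and on to [w]. *)
pose C1 := L + `|r| + (Ld * L + K).
have [C1_1 C1_2] : L + `|r| <= C1 /\ Ld * L + K <= C1.
  by have := mulr_gt0 Ld0 L0; rewrite /C1; split; lra.
have L_C1 : L <= C1 by apply: le_trans C1_1; rewrite lerDl.
have C10 : 0 < C1 := lt_le_trans L0 L_C1.
pose C2 := C1 + Ll * C1.
have C12 : C1 <= C2 by rewrite lerDl mulr_ge0// ltW.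
have C12' : Ll * C1 <= C2 by rewrite lerDr ltW.
have C20 : 0 < C2 := lt_le_trans C10 C12.
exists (C2 + La * C2), (Num.min 1 e1).
split; first by rewrite addr_gt0// mulr_gt0.
  by rewrite lt_min ltr01.
move=> e a q v q' v' l' qs vs; rewrite lt_min => /and3P[e0 elt1 elt1'].
move=> qr vr Dqv st sol qa va.
have e01 : 0 < e <= 1 by rewrite e0 ltW.
have [lE wd wK lK /andP[q'K v'K]] := stepK _ _ _ _ _ _ e01 qr vr Dqv st.
set w := e^-1 *: (mu q' *m v) in lE wd wK.
have r_r1 : r <= r + 1 by rewrite lerDl.
have ab : a <= a + e by rewrite lerDl ltW.
have {}solL t : a <= t <= a + e ->
    [/\ `|qs t| <= r + 1, `|vs t| <= r + 1,
        `|qs t - q| <= L * e & `|vs t - v| <= L * e].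
  rewrite -qa -va; apply: (solL e a qs vs _ sol); rewrite ?qa ?va// e0.
  exact: elt1'.
pose lam t := nh_multiplier M V mu (qs t) (vs t).
have near t : a <= t <= a + e ->
    [/\ `|qs t - q'| <= C2 * e, `|lam t - l'| <= C2 * e, `|qs t| <= s + Bl &
        `|lam t| <= s + Bl].
  move=> /solL[qt vt qd vd].
  have q'd : `|qs t - q'| <= (L + `|r|) * e.
    rewrite st.1.1 opprD addrA mulrDl (le_trans (ler_normB _ _))// lerD//.
    by rewrite normrZ gtr0_norm// mulrC ler_pM2r// (le_trans vr)// ler_norm.
  have wt : `|dmu mu (qs t) (vs t) - w| <= (Ld * L + K) * e.
    rewrite -(subrKA (dmu mu q v)) (le_trans (ler_normD _ _))// mulrDl lerD//.
    rewrite -mulrA.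
    exact: (dL _ _ _ _ _ qt vt (le_trans qr r_r1) (le_trans vr r_r1) qd vd).
  have Bt := dB _ _ qt vt.
  have q'd1 : `|qs t - q'| <= C1 * e by apply: le_trans q'd _; rewrite ler_pM2r.
  have wt1 : `|dmu mu (qs t) (vs t) - w| <= C1 * e.
    by apply: le_trans wt _; rewrite ler_pM2r.
  have qs_s := le_trans qt r_s; have dmu_s := le_trans Bt Bd_s.
  have lt : `|lam t - l'| <= Ll * (C1 * e).
    rewrite lE.
    exact: (lL _ _ _ _ _ qs_s dmu_s (le_trans q'K K_s) (le_trans wK K_s) q'd1 wt1).
  have lamB : `|lam t| <= Bl := lB _ _ qs_s dmu_s.
  split.
  - by apply: le_trans q'd1 _; rewrite ler_pM2r.
  - by apply: le_trans lt _; rewrite mulrA ler_pM2r.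
  - exact: le_trans qs_s s_sl.
  - exact: le_trans lamB Bl_sl.
have LC : 0 < La * C2 by rewrite mulr_gt0.
have C2e : C2 * e <= (C2 + La * C2) * e by rewrite ler_pM2r// lerDl ltW.
have endp : a <= a + e <= a + e by rewrite ab lexx.
have ale : a + e - a = e by rewrite addrC addKr.
split; last by have [_ lt _ _] := near _ endp; apply: le_trans C2e.
  (* The slope [v] is chosen because q' = q + e v, so the inequality bounds the error at the end of
     the step; likewise below for [accel q' l'] and [v']. *)
  have := @mean_value_mx _ _ _ qs vs v a (a + e) (C2 * e) ab.
  rewrite ale qa -addrA -opprD -st.1.1 expr2 => H.
  apply: le_trans (H _ _) _ => [t /sol[]//|t /andP[ta tb]|]; last first.
    by rewrite [leRHS]mulrA ler_pM2r.
  have [|_ _ _ vd] := solL t; first by rewrite !ltW.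
  by apply: le_trans vd _; rewrite ler_pM2r// (le_trans L_C1).
have := @mean_value_mx _ _ _ vs (fun t => accel (qs t) (lam t)) (accel q' l')
  a (a + e) (La * (C2 * e)) ab.
rewrite ale va -addrA -opprD -(velocity_step_accel st) expr2 => H.
apply: le_trans (H _ _) _ => [t /sol[]//|t /andP[ta tb]|]; last first.
  by rewrite [leRHS]mulrA [La * _]mulrA ler_pM2r// ler_pM2r// lerDr ltW.
have [|qd ld qB lamB] := near t; first by rewrite !ltW.
have K_sl := le_trans K_s s_sl.
exact: (aL _ _ _ _ _ qB lamB (le_trans q'K K_sl) (le_trans lK K_sl) qd ld).
Qed.

(** The index is fixed before e tends to 0, so the radius may grow with [k]: each step takes the
    constant of [step_bounded] as the next radius. *)
Lemma iterates_bounded (q v : R -> nat -> 'cV[R]_n) (lam : R -> nat -> 'cV[R]_m)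
    (q0 v0 : 'cV[R]_n) :
  (forall e, 0 < e ->
     [/\ q e 0%N = q0, v e 0%N = v0 &
         forall k, velocity_step M V mu e (q e k) (v e k)
                     (q e k.+1) (v e k.+1) (lam e k.+1)]) ->
  (forall e k, 0 < e -> in_D mu (q e k) (v e k)) ->
  forall k, exists r, forall e, 0 < e <= 1 -> `|q e k| <= r /\ `|v e k| <= r.
Proof.
move=> scheme inD; elim=> [|k [r IH]].
  exists (Num.max `|q0| `|v0|) => e /andP[/scheme[-> -> _] _].
  by rewrite !le_max !lexx orbT.
have [K _ stepK] := step_bounded r.
exists K => e e01; have [e0 _] := andP e01; have [qr vr] := IH e e01.
have [_ _ step] := scheme e e0.
by have [_ _ _ _ /andP[]] := stepK _ _ _ _ _ _ e01 qr vr (inD e k e0) (step k).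
Qed.

End VelocityIntegrator.

(** * The multiplier formula and the order of consistency *)

Theorem proposition6p1 (R : realType) (n m : nat) (M : 'M[R]_n)
    (V : 'cV[R]_n -> R) (mu : 'cV[R]_n -> 'M[R]_(m, n))
    (M_spd : symmetric_posdef M)
    (V_smooth : smooth V)
    (mu_smooth : forall (a : 'I_m) (i : 'I_n), smooth (fun q => mu q a i))
    (mu_free : forall q, row_free (mu q)) :
  (forall (e : R) (q v q' v' : 'cV[R]_n) (l' : 'cV[R]_m),
     0 < e -> in_D mu q v ->
     (velocity_step M V mu e q v q' v' l' <->
      step_update M V mu e q v q' v' l' /\
      l' = step_multiplier M V mu e v q')) /\
  (forall (q v : R -> nat -> 'cV[R]_n) (lam : R -> nat -> 'cV[R]_m)
     (q0 v0 : 'cV[R]_n),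
     in_D mu q0 v0 ->
     (forall e, 0 < e ->
        [/\ q e 0%N = q0, v e 0%N = v0 &
            forall k, velocity_step M V mu e (q e k) (v e k)
                        (q e k.+1) (v e k.+1) (lam e k.+1)]) ->
     consistent_discretization M V mu 1 0 q v lam).
Proof.
split=> [e q v q' v' l' e0 _|q v lam q0 v0 D0 scheme]; first exact: velocity_stepP.
have inD e k : 0 < e -> in_D mu (q e k) (v e k).
  move=> e0; have [q0E v0E step] := scheme e e0.
  by case: k => [|k]; [rewrite q0E v0E|exact: (step k).2].
(* Both position and velocity have local error O(e^2), so r = l = 1, while the multiplier has error
   O(e), which is s = 0. *)
split=> //; exists 1%N, 1%N; split => // t0 k qs vs tk sol.
have [r qvr] := iterates_bounded M_spd V_smooth mu_smooth mu_free scheme inD k.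
have [C [e0 [C0 e00 err]]] := one_step_error M_spd V_smooth mu_smooth mu_free r.
have {}err : \forall e \near 0^'+,
    [/\ `|qs e (tk e + e) - q e k.+1| <= C * e ^+ 2,
        `|vs e (tk e + e) - v e k.+1| <= C * e ^+ 2 &
        `|nh_multiplier M V mu (qs e (tk e + e)) (vs e (tk e + e)) - lam e k.+1|
          <= C * e].
  (* For small e the solution exists on the step, e <= 1 bounds the iterates, and e < e0 allows the
     one-step estimate. *)
  near=> e.
  have e_gt0 : 0 < e by near: e; exact: nbhs_right_gt.
  have [|qr vr] := qvr e.
    by rewrite e_gt0; near: e; exact: nbhs_right_le.
  have [//|sole qe ve] := near sol e.
  have [_ _ step] := scheme e e_gt0.
  apply: err qr vr (inD e k e_gt0) (step k) sole qe ve.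
  by rewrite e_gt0; near: e; exact: nbhs_right_lt.
have eN (e : R) i : 0 < e -> `|e ^+ i| = e ^+ i.
  by move=> ep; rewrite ger0_norm// exprn_ge0// ltW.
split; apply/eqO_exP; exists C => //; near=> e.
all: have e_gt0 : 0 < e by near: e; exact: nbhs_right_gt.
all: by rewrite eN// ?expr1; have [] := near err e.
Unshelve. all: by end_near. Qed.
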